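(* Let $\Gamma$ be a distance-regular graph with classical parameters $(D,b,\alpha,\beta)$ such that $b\ge 2$ and $D\ge 3$. Let $s$ be a positive integer and assume $\Gamma$ has the SPLS$(s)$ property. Let $r=[D]$. Assume that (1) $\beta > (b+2)(b+1)(s-1) - (b(b+1)+r-1)\alpha$; (2) $\beta > ((b+1)(b^2+b+1)-2)(s-b) - \alpha(b+1)r + \alpha(b+1)^2$; (3) $\beta > ((b+1)(b^2+b+1)-2+b)(s-b) - \alpha(r-1) + b^2 - b$. Then $\Gamma$ is geometric.
   Context: Distance-regular graph with intersection numbers $b_i,c_i$, valency $k=b_0$, $a_i=k-b_i-c_i$. For integer $b\ne 1$, $[j]=\frac{b^j-1}{b-1}$. Classical parameters $(D,b,\alpha,\beta)$: diameter $D$, $b_i=([D]-[i])(\beta-\alpha[i])$ ($0\le i\le D-1$), $c_i=[i](1+\alpha[i-1])$ ($1\le i\le D$). A partial linear space: points and lines, any two distinct points on at most one common line; point graph: points adjacent iff on a common line. $\tau(X)$: maximum over non-incident point $x$ and line $\ell$ of the number of points of $\ell$ collinear with $x$. For integers $c\ge1,s\ge2$, $\Gamma$ has the SPLS$(c,s)$ property if $\Gamma$ is the point graph of a partial linear space $X=(V(\Gamma),\mathcal L,\in)$ with $\mathcal L$ the set of all maximal cliques with at least $a_1+2-(c-1)(s-1)$ vertices, $a_1\ge(2s-1)(c-1)$, each vertex on at most $s$ lines, and $\tau(X)\le c$; SPLS$(s)$ means SPLS$(c_2,s)$. With $\theta_{\min}$ the smallest adjacency eigenvalue, a Delsarte clique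 is a clique of size $1+\frac{k}{-\theta_{\min}}$; $\Gamma$ is geometric if there is a set of Delsarte cliques such that every edge lies in exactly one of them. *)

(* Defs.v *)
From mathcomp Require Import all_boot all_order all_algebra.
Set Implicit Arguments. Unset Strict Implicit. Unset Printing Implicit Defensive.
Import Order.TTheory GRing.Theory Num.Theory.

Section Graphs.
Variable T : finType.
Variable adj : rel T.

Fixpoint within (n : nat) (x y : T) : bool :=
  match n with
  | 0 => x == y
  | n'.+1 => within n' x y || [exists z, within n' x z && adj z y]
  end.

Definition dist_is (x y : T) (i : nat) : bool :=
  within i x y && ((i == 0) || ~~ within i.-1 x y).

Definition is_drg (D : nat) (bs cs : nat -> nat) : Prop :=
  [/\ symmetric adj, irreflexive adj,
      (forall x y, within D x y),
      (exists x y, dist_is x y D) &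
      (forall i x y, dist_is x y i ->
         (i < D -> #|[set z | adj y z & dist_is x z i.+1]| = bs i) /\
         (0 < i -> #|[set z | adj y z & dist_is x z i.-1]| = cs i))].

Definition clique (C : {set T}) : bool :=
  [forall x in C, forall y in C, (x != y) ==> adj x y].

Definition maxclique (C : {set T}) : bool :=
  clique C && [forall C' : {set T}, (clique C' && (C \subset C')) ==> (C' == C)].

Definition lines (m : nat) : {set {set T}} :=
  [set C : {set T} | maxclique C && (m <= #|C|)].

Definition spls (a1 c s : nat) : Prop :=
  [/\ 1 <= c, 2 <= s, (2 * s - 1) * (c - 1) <= a1 &
   let L := lines (a1 + 2 - (c - 1) * (s - 1)) in
   [/\
       (forall x y, x != y -> #|[set l in L | (x \in l) && (y \in l)]| <= 1),
       (forall x y, adj x y <-> (x != y /\ exists2 l, l \in L & (x \in l) && (y \in l))),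
       (forall x, #|[set l in L | x \in l]| <= s) &
       (forall x l, l \in L -> x \notin l ->
          #|[set y in l | [exists l' in L, (x \in l') && (y \in l')]]| <= c)]].

Variable R : rcfType.
Local Open Scope ring_scope.

Definition adjmx : 'M[R]_#|T| :=
  \matrix_(i, j) (adj (enum_val i) (enum_val j))%:R.

Definition is_min_eigenvalue (A : 'M[R]_#|T|) (th : R) : Prop :=
  eigenvalue A th /\ forall th', eigenvalue A th' -> th <= th'.

Definition delsarte (k : nat) (th : R) (C : {set T}) : Prop :=
  clique C /\ (#|C|%:R = 1 + k%:R / (- th)).

Definition geometric (k : nat) : Prop :=
  exists th, is_min_eigenvalue adjmx th /\
  exists S : {set {set T}},
    (forall C, C \in S -> delsarte k th C) /\
    (forall x y, adj x y -> #|[set C in S | (x \in C) && (y \in C)]| = 1%N).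

End Graphs.

Local Open Scope ring_scope.

Definition qbr (R : rcfType) (b j : nat) : R := (b%:R ^+ j - 1) / (b%:R - 1).

Definition classical_params (R : rcfType) (D b : nat) (alpha beta : R)
    (bs cs : nat -> nat) : Prop :=
  (forall i, (i < D)%N ->
     (bs i)%:R = (qbr R b D - qbr R b i) * (beta - alpha * qbr R b i)) /\
  (forall i, (1 <= i <= D)%N ->
     (cs i)%:R = qbr R b i * (1 + alpha * qbr R b i.-1)).

Arguments qbr : clear implicits.
Arguments classical_params : clear implicits.
Arguments geometric {T} adj R k.

(* Main.v *)
Require Import Defs.
From mathcomp Require Import all_boot all_order all_algebra.
From mathcomp Require Import ring lra zify.
Set Implicit Arguments. Unset Strict Implicit. Unset Printing Implicit Defensive.
Import Order.TTheory GRing.Theory Num.Theory.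

(** The smallest eigenvalue is [- r], so lines have at most [1 + beta] points and
    every point is on at least [r] of them; since [k = r beta], it suffices that
    no point is on more than [r] lines.  For [x], [y] at distance 2, call a line
    through [x] near to [y] if all its points are within distance 2 of [y].
    Counting the neighbours of [x] within distance 2 of [y], assumption (1) bounds
    the number of near lines, and also the number of points of a line collinear
    with a point off it, by [b + 1]; a line through [x] that is not near to [y]
    has few points at distance 2 from [y] (count paths to a point at distance 3),
    so by (2) there are exactly [b + 1] near lines.  By (3) the set of lines
    through [x] near to [y] is the same for all [y] at distance 2 from [x] on a
    line meeting [Gamma(x)].  Double counting then shows that collinear points
    are on equally many lines, so all points are on the same number [t] of lines.
    There are fewer lines than points, so the incidence matrix [N] has a
    kernel and [A + t I = N N^T] is singular; hence [- t >= - r]. *)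

(** * Distance in a graph of bounded diameter *)

Section Distance.
Variables (T : finType) (adj : rel T) (D : nat).
Hypothesis adj_sym : symmetric adj.
Hypothesis adj_irr : irreflexive adj.
Hypothesis diam : forall x y, within adj D x y.

Lemma within_leq m n x y : m <= n -> within adj m x y -> within adj n x y.
Proof.
move=> /subnK <-; elim: (n - m) => [//|i IH] H.
by rewrite addSn /= IH.
Qed.

Lemma within_rcons n x z y : within adj n x z -> adj z y -> within adj n.+1 x y.
Proof. by move=> xz zy /=; apply/orP; right; apply/existsP; exists z; rewrite xz. Qed.

Lemma within_cons n x z y : adj x z -> within adj n z y -> within adj n.+1 x y.
Proof.
elim: n y => [|n IH] y xz.
  by move/eqP=> <-; apply: within_rcons xz; rewrite /= eqxx.
rewrite [within _ n.+1 _ _]/= => /orP[/(IH _ xz)|/existsP[w /andP[zw wy]]].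
  exact: within_leq.
exact: within_rcons (IH _ xz zw) wy.
Qed.

Lemma within_sym n x y : within adj n x y -> within adj n y x.
Proof.
elim: n y => [|n IH] y /=; first by rewrite eq_sym.
case/orP=> [/IH ->//|/existsP[w /andP[/IH xw wy]]].
by rewrite adj_sym in wy; apply: within_cons wy xw.
Qed.

(** The search stops at a radius at most [D] because [diam] bounds all distances, so the default
    value [D.+1] of [find] does not occur. *)
Definition gdist x y := find (fun n => within adj n x y) (iota 0 D.+1).

Lemma gdist_le x y n : (gdist x y <= n) = within adj n x y.
Proof.
have hasD : has (fun n => within adj n x y) (iota 0 D.+1).
  by apply/hasP; exists D; rewrite ?mem_iota //= ltnS.
apply/idP/idP => [le_n|wn].
  apply: within_leq le_n _.
  have := nth_find 0 hasD; rewrite nth_iota //.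
  by move: hasD; rewrite has_find size_iota.
rewrite leqNgt; apply/negP => lt_n.
have := before_find 0 lt_n; rewrite nth_iota ?add0n ?wn //.
by move: hasD; rewrite has_find size_iota; apply: ltn_trans.
Qed.

Lemma gdist_leD x y : gdist x y <= D.
Proof. by rewrite gdist_le. Qed.

Lemma gdistC x y : gdist x y = gdist y x.
Proof.
by apply/eqP; rewrite eqn_leq !gdist_le; apply/andP; split;
  apply: within_sym; rewrite -gdist_le.
Qed.

Lemma gdist_eq0 x y : (gdist x y == 0) = (x == y).
Proof. by rewrite -leqn0 gdist_le. Qed.

Lemma gdistxx x : gdist x x = 0.
Proof. by apply/eqP; rewrite gdist_eq0. Qed.

Lemma gdist_step x y z : adj y z -> gdist x z <= (gdist x y).+1.
Proof. by move=> yz; rewrite gdist_le; apply: within_rcons yz; rewrite -gdist_le. Qed.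

Lemma gdist_eq1 x y : (gdist x y == 1) = adj x y.
Proof.
rewrite eqn_leq gdist_le lt0n gdist_eq0 /=.
apply/andP/idP => [[/orP[/eqP -> /eqP //|/existsP[z /andP[/eqP <- //]]] _]|xy].
split; last by apply/eqP => exy; rewrite exy adj_irr in xy.
by apply/orP; right; apply/existsP; exists x; rewrite eqxx.
Qed.

Lemma gdist_pred x y i : gdist x y = i.+1 -> exists2 z, gdist x z = i & adj z y.
Proof.
move=> dxy; have : within adj i.+1 x y by rewrite -gdist_le dxy.
rewrite /= => /orP[|/existsP[z /andP[xz zy]]].
  by rewrite -gdist_le dxy ltnn.
exists z => //; apply/eqP; rewrite eqn_leq gdist_le xz.
by have := gdist_step x zy; rewrite dxy ltnS.
Qed.

Lemma dist_isE x y i : dist_is adj x y i = (gdist x y == i).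
Proof.
rewrite /dist_is -!gdist_le; case: i => [|i] /=; first by rewrite andbT leqn0.
by rewrite -ltnNge -eqn_leq.
Qed.

Lemma gdist_all x y i : i <= gdist x y -> exists z, gdist x z = i.
Proof.
move: {2}(gdist x y - i) (erefl (gdist x y - i)) => n.
elim: n y => [|n IH] y def_n le_i; first by exists y; lia.
have [z dz _] : exists2 z, gdist x z = (gdist x y).-1 & adj z y.
  by apply: gdist_pred; lia.
by apply: (IH z); lia.
Qed.

End Distance.

(** * Partial linear spaces *)

Section PartialLinearSpace.
Variables (T : finType) (adj : rel T) (L : {set {set T}}).
Hypothesis adj_sym : symmetric adj.
Hypothesis adj_irr : irreflexive adj.
Hypothesis L_max : forall l, l \in L -> maxclique adj l.
Hypothesis L_one : forall x y, x != y ->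
  #|[set l in L | (x \in l) && (y \in l)]| <= 1.
Hypothesis adj_L : forall x y,
  adj x y <-> x != y /\ exists2 l, l \in L & (x \in l) && (y \in l).

Definition through x := [set l in L | x \in l].

Lemma throughP x l : reflect (l \in L /\ x \in l) (l \in through x).
Proof. by rewrite inE; apply: andP. Qed.

Lemma line_eq x y l m : x != y -> l \in L -> m \in L ->
  x \in l -> y \in l -> x \in m -> y \in m -> l = m.
Proof.
move=> xy lL mL xl yl xm ym; apply: (card_le1_eqP (L_one xy));
  by rewrite inE ?lL ?mL ?xl ?xm ?yl ?ym.
Qed.

Lemma line_adj x y l : l \in L -> x \in l -> y \in l -> x != y -> adj x y.
Proof. by move=> lL xl yl xy; apply/adj_L; split=> //; exists l; rewrite ?xl. Qed.

Lemma adj_line x y : adj x y -> exists2 l, l \in through x & y \in l.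
Proof. by case/adj_L=> _ [l lL /andP[xl yl]]; exists l => //; rewrite inE lL. Qed.

(** The lines through [x], with [x] removed, partition its neighbours: [adj_L] gives one line for
    each neighbour and [L_one] makes it unique. Values in an [nmodType] allow both counting in [nat]
    and summing eigenfunctions. *)
Lemma sum_lines (V : nmodType) (F : T -> V) x :
  (\sum_(z | adj x z) F z = \sum_(l in through x) \sum_(z in l | z != x) F z)%R.
Proof.
rewrite (exchange_big_dep (adj x)) /=; last first.
  by move=> l z /throughP[lL xl] /andP[zl zx]; rewrite (line_adj lL) // eq_sym.
apply: eq_bigr => z xz; have [l lx zl] := adj_line xz.
have zx : z != x by apply: contraTneq xz => ->; rewrite adj_irr.
rewrite (big_pred1 l) // => m; rewrite zx andbT /=.
apply/andP/eqP => [[/throughP[mL xm] zm]|->//].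
by have /throughP[lL xl] := lx; apply: (line_eq zx).
Qed.

Lemma card_lines (P : pred T) x :
  #|[set z | adj x z & P z]| =
  \sum_(l in through x) #|[set z in l | (z != x) && P z]|.
Proof.
rewrite -sum1_card (eq_bigl (fun z => adj x z && P z)); last by move=> z; rewrite inE.
rewrite big_mkcondr (sum_lines (V := nat)); apply: eq_bigr => l _.
rewrite -big_mkcondr -sum1_card; apply: eq_bigl => z.
by rewrite inE andbA.
Qed.

Lemma degree_lines x : #|[set z | adj x z]| = \sum_(l in through x) #|l|.-1.
Proof.
have -> : [set z | adj x z] = [set z | adj x z & true] by apply/setP=> z; rewrite !inE andbT.
rewrite card_lines; apply: eq_bigr => l /throughP[_ xl].
rewrite (cardsD1 x l) xl /=; apply: eq_card => z.
by rewrite !inE andbT andbC.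
Qed.

(** Otherwise [x |: l] would be a clique larger than the maximal clique [l]. *)
Lemma line_nonadj l x : l \in L -> x \notin l -> exists2 y, y \in l & ~~ adj x y.
Proof.
move=> lL xl; apply/exists_inP; apply: contraNT xl => /exists_inPn H.
have /andP[/forall_inP cl /forallP/(_ (x |: l))] := L_max lL.
rewrite subsetUr andbT => /implyP/(_ _)/eqP <-; rewrite ?setU11 //.
have all_adj y : y \in l -> adj x y by move=> yl; rewrite -[adj x y]negbK H.
apply/forall_inP => y; rewrite in_setU1 => /orP[/eqP ->|yl]; apply/forall_inP => z;
  rewrite in_setU1 => /orP[/eqP ->|zl]; apply/implyP => yz.
- by rewrite eqxx in yz.
- exact: all_adj.
- by rewrite adj_sym all_adj.
- by have /forall_inP/(_ z zl)/implyP := cl y yl; apply.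
Qed.

Definition trace x (l : {set T}) := [set y in l | adj x y].

(** Common neighbours of [x] and [z] are the other points of [l], together with at most [tau - 1]
    points on each further line through [x], since [x] already accounts for one point of that line
    collinear with [z]. With a known number of common neighbours this is a lower bound on line
    sizes. *)
Lemma common_lines x z l tau s :
  l \in L -> x \in l -> z \in l -> x != z -> #|through x| <= s ->
  (forall y m, m \in L -> y \notin m -> #|trace y m| <= tau) ->
  #|[set y | adj x y & adj z y]| + 2 <= #|l| + (s - 1) * (tau - 1).
Proof.
move=> lL xl zl xz ts tau_le; rewrite card_lines (bigD1 l) ?inE ?lL //=.
have -> : #|l| = #|[set y in l | (y != x) && adj z y]| + 2.
  rewrite (cardsD1 x) xl (cardsD1 z) !inE eq_sym xz zl /= addn2.
  congr _.+2; apply: eq_card => y; rewrite !inE.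
  have [->|yz] := eqVneq y z; first by rewrite adj_irr !andbF.
  case: (boolP (y \in l)) => [yl|]; last by rewrite !andbF.
  by rewrite (line_adj lL zl yl) 1?eq_sym // !andbT.
rewrite addnAC leq_add2l.
apply: (@leq_trans (\sum_(m in through x | m != l) (tau - 1))).
  apply: leq_sum => m /andP[/throughP[mL xm] ml].
  have zm : z \notin m.
    by apply: contra ml => zm; apply/eqP; apply: (line_eq xz).
  rewrite leq_subRL; last first.
    apply: leq_trans (tau_le z m mL zm); rewrite card_gt0; apply/set0Pn.
    by exists x; rewrite inE xm (line_adj lL) // eq_sym.
  apply: leq_trans (tau_le z m mL zm); rewrite (cardsD1 x (trace z m)).
  rewrite inE xm (line_adj lL zl xl) 1?eq_sym //= leq_add2l.
  by apply: subset_leq_card; apply/subsetP => y; rewrite !inE => /and3P[-> -> ->].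
rewrite sum_nat_const leq_mul2r; apply/orP; right.
have -> : #|[pred m in through x | m != l]| = #|through x :\ l|.
  by apply: eq_card => m; rewrite !inE andbC.
have := cardsD1 l (through x); rewrite inE lL xl /= => E; rewrite E in ts. rewrite -ltnS subn1; case: s ts => //.
Qed.

End PartialLinearSpace.

(** * Lines through a point seen from a point at distance 2 *)

Section Lines.
Variables (T : finType) (adj : rel T) (L : {set {set T}}) (D : nat).
Hypothesis adj_sym : symmetric adj.
Hypothesis adj_irr : irreflexive adj.
Hypothesis diam : forall x y, within adj D x y.
Hypothesis L_max : forall l, l \in L -> maxclique adj l.
Hypothesis L_one : forall x y, x != y ->
  #|[set l in L | (x \in l) && (y \in l)]| <= 1.
Hypothesis adj_L : forall x y,
  adj x y <-> x != y /\ exists2 l, l \in L & (x \in l) && (y \in l).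

Local Notation d := (gdist adj D).
Local Notation through := (through L).
Local Notation trace := (trace adj).

Definition near x y := [set l in through x | [forall u in l, d y u <= 2]].

Lemma nearP x y l : reflect (l \in through x /\ forall u, u \in l -> d y u <= 2) (l \in near x y).
Proof.
by apply: (iffP setIdP) => -[lx H]; split=> //; apply/forall_inP.
Qed.

Lemma big_near x y (F : {set T} -> nat) :
  \sum_(l in through x | l \in near x y) F l = \sum_(l in near x y) F l.
Proof. by apply: eq_bigl => l; rewrite andb_idl // => /nearP[]. Qed.

Lemma gdist_line x y z l : l \in L -> y \in l -> z \in l -> d x z <= (d x y).+1.
Proof.
move=> lL yl zl; have [->|yz] := eqVneq y z; first exact: leqnSn.
by apply: gdist_step => //; apply: (line_adj adj_L lL).
Qed.

Lemma near_sum_le x y :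
  \sum_(l in near x y) #|l|.-1 <= #|[set z | adj x z & d y z <= 2]|.
Proof.
rewrite (card_lines adj_irr L_one adj_L) [X in _ <= X](bigID [in near x y]) /=.
apply: leq_trans _ (leq_addr _ _).
rewrite big_near.
apply: leq_sum => l /nearP[/throughP[_ xl] dl].
rewrite (cardsD1 x l) xl /=; apply: subset_leq_card; apply/subsetP => z.
by rewrite !inE => /andP[-> zl]; rewrite zl dl.
Qed.

(** A neighbour [z] of [x] on [m] is within distance 1 of [y], so the line [xz] is near to [y];
    distinct [z] give distinct lines because [x] is not on [m]. *)
Lemma trace_near x y m : m \in L -> x \notin m -> y \in m -> ~~ adj x y ->
  #|trace x m| <= #|near x y|.
Proof.
move=> mL xm ym xy.
have -> : trace x m = [set z | adj x z & z \in m].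
  by apply/setP => z; rewrite !inE andbC.
rewrite (card_lines adj_irr L_one adj_L) -[X in _ <= X]sum1_card.
rewrite (bigID [in near x y]) /= [X in _ + X]big1 ?addn0; last first.
  move=> l /andP[/[dup] lx /throughP[lL xl] lS]; apply/eqP; rewrite cards_eq0.
  apply: contraNT lS => /set0Pn[z]; rewrite !inE => /and3P[zl zx zm].
  rewrite lL xl; apply/forall_inP => u ul.
  apply: leq_trans (gdist_line y lL zl ul) _; rewrite ltnS.
  by have := gdist_line y mL ym zm; rewrite gdistxx.
rewrite big_near.
apply: leq_sum => l /nearP[/throughP[lL xl] _].
apply/card_le1_eqP => u v; rewrite !inE => /and3P[ul ux um] /and3P[vl vx vm].
apply/eqP; apply: contraNT xm => uv.
by rewrite -(line_eq L_one uv lL mL).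
Qed.

(** The line joining [x] to a common neighbour is near to [y]. It misses [y], which is at distance 2
    from [x], so it carries at most [tau] common neighbours. *)
Lemma common_near x y tau : d x y = 2 ->
  (forall y m, m \in L -> y \notin m -> #|trace y m| <= tau) ->
  #|[set z | adj x z & adj y z]| <= #|near x y| * tau.
Proof.
move=> dxy tau_le; rewrite (card_lines adj_irr L_one adj_L) -sum_nat_const.
rewrite (bigID [in near x y]) /= [X in _ + X]big1 ?addn0; last first.
  move=> l /andP[/[dup] lx /throughP[lL xl] lS]; apply/eqP; rewrite cards_eq0.
  apply: contraNT lS => /set0Pn[z]; rewrite !inE => /and3P[zl zx yz].
  rewrite lL xl; apply/forall_inP => u ul.
  apply: leq_trans (gdist_line y lL zl ul) _; rewrite ltnS.
  by move: yz; rewrite -(gdist_eq1 adj_irr diam) => /eqP ->.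
rewrite big_near.
apply: leq_sum => l /nearP[/throughP[lL xl] _].
have yl : y \notin l.
  apply/negP => yl; have := gdist_line x lL xl yl; by rewrite gdistxx // dxy.
apply: leq_trans (tau_le y l lL yl).
by apply: subset_leq_card; apply/subsetP => u; rewrite !inE => /and3P[-> _ ->].
Qed.

(** For [l] through [x] this says that [l] is in [near x y] for every [y] on [m]; being symmetric,
    it can be double counted from either line. *)
Definition perp (l m : {set T}) := [forall u in l, forall y in m, d u y <= 2].

Lemma perpC l m : perp l m = perp m l.
Proof.
apply/forall_inP/forall_inP => H u ul; apply/forall_inP => y yl;
  by rewrite (gdistC adj_sym diam); have /forall_inP := H y yl; apply.
Qed.

Lemma perp_meet z l m : l \in L -> m \in L -> z \in l -> z \in m -> perp l m.
Proof.
move=> lL mL zl zm; apply/forall_inP => u ul; apply/forall_inP => y ym.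
apply: leq_trans (gdist_line u mL zm ym) _; rewrite ltnS.
by have := gdist_line u lL ul zl; rewrite gdistxx.
Qed.

Variables (b s M c2 c3 : nat).
Hypothesis through_le : forall x, #|through x| <= s.
Hypothesis trace_le : forall y m, m \in L -> y \notin m -> #|trace y m| <= b.+1.
Hypothesis card_c2 : forall x y, d x y = 2 -> #|[set z | adj x z & adj y z]| = c2.
Hypothesis card_c3 : forall x w, d x w = 3 -> #|[set z | adj x z & d w z == 2]| = c3.
Hypothesis c2_gt0 : 0 < c2.
Hypothesis c3_le : c3 * b.+1 <= M * c2.

(* Count the edges between the points [y] of [l] at distance 2 from [x] and the
   neighbours [z] of [x]: any such [z] is at distance 2 from [w]. *)
Lemma sphere2_line x w l : l \in L -> w \in l -> 2 < d x w ->
  #|[set y in l | d x y == 2]| <= M.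
Proof.
move=> lL wl dxw; set Y := [set y in l | _].
have [->|/set0Pn[y0]] := eqVneq Y set0; first by rewrite cards0.
rewrite inE => /andP[y0l /eqP dy0].
have dw : d x w = 3 by have := gdist_line x lL y0l wl; rewrite dy0 => le3; apply/eqP; rewrite eqn_leq le3.
rewrite -(leq_pmul2r c2_gt0); apply: leq_trans c3_le.
rewrite -(card_c3 dw) -!sum_nat_const.
rewrite (eq_bigr (fun y => \sum_(z | adj x z && adj y z) 1)); last first.
  move=> y; rewrite inE => /andP[_ /eqP /card_c2 <-].
  by rewrite -sum1_card; apply: eq_bigl => z; rewrite inE.
rewrite (exchange_big_dep (mem [set z | adj x z & d w z == 2])) /=; last first.
  move=> y z; rewrite !inE => /andP[yl /eqP dxy] /andP[xz yz]; rewrite xz /=.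
  rewrite eqn_leq; apply/andP; split.
    apply: leq_trans (gdist_step diam w yz) _; rewrite ltnS.
    by have := gdist_line w lL wl yl; rewrite gdistxx.
  have := gdist_step diam w (_ : adj z x); rewrite adj_sym xz => /(_ isT).
  by rewrite gdistC // dw ltnS.
apply: leq_sum => z; rewrite inE => /andP[xz /eqP dwz].
have zl : z \notin l.
  by apply/negP => zl; have := gdist_line w lL wl zl; rewrite gdistxx // dwz.
apply: leq_trans (trace_le lL zl).
rewrite sum1_card; apply: subset_leq_card; apply/subsetP => y.
by rewrite [_ \in (fun _ => _)]/in_mem /= !inE => /andP[/andP[-> _] /andP[_]]; rewrite adj_sym.
Qed.

(** A line through [x] that is not near to [y] meets the sphere of radius 2 about [y] in at most [M]
    points, one of which is [x]. As [M.-1 <= beta], the worst case is [b] near lines among [s]. *)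
Lemma near_sum_ge x y beta : d x y = 2 -> M.-1 <= beta ->
  (forall l, l \in L -> #|l|.-1 <= beta) ->
  b < s -> #|near x y| <= b ->
  #|[set z | adj x z & d y z <= 2]| <= b * beta + (s - b) * M.-1.
Proof.
move=> dxy Mbeta l_le lt_bs le_b; rewrite (card_lines adj_irr L_one adj_L).
rewrite (bigID [in near x y]) /=.
apply: (@leq_trans (#|near x y| * beta + (#|through x| - #|near x y|) * M.-1)); last first.
  have := through_le x; nia.
apply: leq_add.
  rewrite -sum_nat_const big_near.
  apply: leq_sum => l /nearP[/throughP[lL xl] _]; apply: leq_trans (l_le l lL).
  rewrite (cardsD1 x l) xl /=; apply: subset_leq_card; apply/subsetP => z.
  by rewrite !inE => /and3P[-> -> _].
have -> : #|through x| - #|near x y| = #|through x :\: near x y|.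
  rewrite cardsD (setIidPr _) //; apply/subsetP => l /nearP[] //.
rewrite -sum_nat_const [X in X <= _](eq_bigl (fun l => l \in through x :\: near x y)); last first.
  by move=> l; rewrite in_setD andbC.
apply: leq_sum => l; rewrite in_setD => /andP[lS /[dup] lx /throughP[lL xl]].
have [w wl dyw] : exists2 w, w \in l & 2 < d y w.
  apply/exists_inP; apply: contraR lS => /exists_inPn H; apply/nearP; split=> // u ul.
  by rewrite leqNgt H.
have := sphere2_line lL wl dyw; rewrite (cardsD1 x) inE xl gdistC // dxy eqxx /=.
move=> le_M; rewrite -ltnS (leq_trans _ (leqSpred _)) //.
apply: leq_trans le_M; rewrite add1n ltnS.
apply: subset_leq_card; apply/subsetP => z; rewrite !inE => /and3P[zl zx le2].
by rewrite zx zl /= eqn_leq le2 -ltnS (leq_trans dyw) // (gdist_line y lL zl wl).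
Qed.

(** * Lines near to every point of a given line *)

Section Perp.
Hypothesis near_card : forall x y, d x y = 2 -> #|near x y| = b.+1.
Hypothesis lt_bs : b < s.
Hypothesis line_gt : forall l, l \in L -> (s - b) * M.-1 < #|l|.-1.

(* If fewer than [b.+1] lines through [x] were near to all points of [m],
   double counting the pairs [(y, l')] with [y] in [m] at distance 2 from [x]
   and [l'] in [near x y] would bound the size of [m]. *)
Lemma perp_card x z l m : l \in L -> x \in l -> z \in l -> x != z ->
  m \in L -> z \in m -> m != l -> #|[set l' in through x | perp l' m]| = b.+1.
Proof.
move=> lL xl zl xz mL zm ml; set P := [set l' in _ | _].
have xm : x \notin m by apply: contra ml => xm; apply/eqP/(line_eq L_one xz).
have xz_adj := line_adj adj_L lL xl zl xz.
have dm y : y \in m -> d x y <= 2.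
  move=> ym; apply: leq_trans (gdist_line x mL zm ym) _.
  by move: xz_adj; rewrite -(gdist_eq1 adj_irr diam) => /eqP ->.
pose Y := [set y in m | d x y == 2]; pose N := [set y in m | d x y <= 1].
have mE : #|m| = #|Y| + #|N|.
  rewrite -(cardsID Y m); congr (_ + _); apply: eq_card => y; rewrite !inE.
    by rewrite andbA andbb.
  have [ym|] := boolP (y \in m); last by rewrite !andbF.
  by rewrite /= andbT neq_ltn ltnS [2 < _]ltnNge dm // orbF.
have [y0 y0m ny0] := line_nonadj adj_sym L_max mL xm.
have y0Y : y0 \in Y.
  have xy0 : x != y0 by apply: contraNneq xm => ->.
  rewrite inE y0m eqn_leq dm //= ltn_neqAle lt0n gdist_eq0 // xy0.
  by rewrite eq_sym gdist_eq1 // ny0.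
have zN : z \in N by rewrite inE zm leq_eqVlt gdist_eq1 // xz_adj.
have lP : l \in P.
  by rewrite !inE lL xl (perp_meet lL mL zl zm).
have P_near y : y \in Y -> P \subset near x y.
  rewrite inE => /andP[ym _]; apply/subsetP => l'; rewrite inE => /andP[lx pl].
  apply/nearP; split=> // u ul; rewrite gdistC //.
  by have /forall_inP/(_ u ul)/forall_inP/(_ y ym) := pl.
have card_near y : y \in Y -> #|near x y| = b.+1.
  by rewrite inE => /andP[_ /eqP]; apply: near_card.
have P_le : #|P| <= b.+1 by rewrite -(card_near y0 y0Y) subset_leq_card // P_near.
apply/eqP; rewrite eqn_leq P_le leqNgt; apply/negP => P_lt.
(* Each [y] in [Y] has [b.+1 - #|P|] near lines outside [P]. A line [l'] outside [P] has a point [u]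
   at distance more than 2 from some point of [m]; the [y] it is near to, and all of [N], lie on the
   sphere of radius 2 about [u], so [sphere2_line] leaves at most [M - #|N|] such [y]. *)
have count : #|Y| * (b.+1 - #|P|) <= (#|through x| - #|P|) * (M - #|N|).
  have -> : #|through x| - #|P| = #|through x :\: P|.
    rewrite cardsD (setIidPr _) //; apply/subsetP => l'; by rewrite inE => /andP[].
  rewrite -!sum_nat_const.
  rewrite (eq_bigr (fun y => \sum_(l' in near x y :\: P) 1)); last first.
    by move=> y yY; rewrite sum1_card cardsD (setIidPr (P_near y yY)) card_near.
  rewrite (exchange_big_dep (mem (through x :\: P))) /=; last first.
    by move=> y l' yY; rewrite !in_setD => /andP[-> /nearP[]].
  apply: leq_sum => l' /setDP[lx lNP].
  have [u ul [y1 y1m d1]] : exists2 u, u \in l' & exists2 y, y \in m & 2 < d u y.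
    have : ~~ perp l' m by apply: contra lNP => pl; rewrite inE lx.
    move=> /forall_inPn[u ul /forall_inPn[y ym dy]].
    by exists u => //; exists y => //; rewrite ltnNge.
  have /throughP[lL' xl'] := lx.
  have du y : y \in m -> d u y <= 2 -> d u y == 2.
    by move=> ym le2; rewrite eqn_leq le2 -ltnS (leq_trans d1) // (gdist_line u mL ym y1m).
  have := sphere2_line mL y1m d1; set Z := [set y in m | _] => Z_le.
  suff : #|[set y in Y | l' \in near x y]| + #|N| <= #|Z|.
    rewrite sum1_card => le_Z.
    have -> : #|[pred y in Y | l' \in near x y :\: P]| = #|[set y in Y | l' \in near x y]|.
      by apply: eq_card => y; rewrite [RHS]in_set -topredE /= in_setD lNP.
    by rewrite leq_subRL ?(leq_trans _ Z_le) 1?addnC ?(leq_trans le_Z) // (leq_trans _ le_Z) ?leq_addl.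
  rewrite -cardsUI [X in _ + X](_ : _ = 0) ?addn0; last first.
    apply/eqP; rewrite cards_eq0; apply/eqP/setP => y; rewrite !inE.
    by case: (d x y =P 2) => [->|_]; rewrite ?andbF.
  apply: subset_leq_card; apply/subsetP => y; rewrite in_setU => /orP[].
    rewrite !inE => /andP[/andP[ym _] /andP[_ /forall_inP/(_ u ul)]].
    by rewrite ym gdistC //; apply: du.
  rewrite !inE => /andP[ym dy]; rewrite ym; apply: du => //.
  rewrite gdistC //; apply: leq_trans (gdist_line y lL' xl' ul) _.
  by rewrite gdistC.
have P_gt0 : 0 < #|P| by rewrite card_gt0; apply/set0Pn; exists l.
have N_gt0 : 0 < #|N| by rewrite card_gt0; apply/set0Pn; exists z.
have := line_gt mL; have := through_le x; rewrite mE.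
have Y_gt0 : 0 < #|Y| by rewrite card_gt0; apply/set0Pn; exists y0.
move: Y_gt0 count P_gt0 N_gt0 P_lt; clear -lt_bs.
move: #|Y| #|P| #|N| #|through x| => {}Y p n t Y_gt0 count p0 n0 pb ts {}line_gt.
(* Here [t - p <= (b - p) + (s - b)] and [s - b >= 1]. Cancelling [b.+1 - p] in [count] bounds [Y],
   and then [Y + n - 1 <= (s - b) (M - 1)] contradicts [line_gt]. *)
have le1 : t - p <= (b.+1 - p) * (s - b) by nia.
have le2 : Y <= (s - b) * (M - n).
  rewrite -(@leq_pmul2l (b.+1 - p)) ?subn_gt0 // mulnC (leq_trans count) //.
  by rewrite mulnA leq_mul2r le1 orbT.
have lt_nM : n < M.
  by rewrite ltnNge -subn_eq0; apply/eqP => E; move: le2 Y_gt0; rewrite E muln0; case: (Y).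
nia.
Qed.

(** Let [l] be the line [xz]. Count pairs in relation [perp] formed by a line through [x] and a line
    through [z], both other than [l]: every such line is in exactly [b] pairs. *)
Lemma through_adj x z : 0 < b -> adj x z -> #|through x| = #|through z|.
Proof.
move=> b_gt0 xz; have [l lx zl] := adj_line adj_L xz.
have /throughP[lL xl] := lx; have lz : l \in through z by rewrite inE lL.
have xz_neq : x != z by apply: contraTneq xz => ->; rewrite adj_irr.
have count u v : u != v -> u \in l -> v \in l ->
    \sum_(m in through v :\ l) \sum_(l' in through u :\ l | perp l' m) 1
    = #|through v :\ l| * b.
  move=> uv ul vl; rewrite -sum_nat_const; apply: eq_bigr => m.
  rewrite !inE => /and3P[ml mL vm]; rewrite sum1_card.
  have := perp_card lL ul vl uv mL vm ml.
  (* One of the [b.+1] lines given by [perp_card] is [l] itself. *)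
  rewrite (cardsD1 l) !inE lL ul (perp_meet lL mL vl vm) => -[<-].
  by apply: eq_card => l'; rewrite [l' \in (fun _ => _)]/in_mem /= !inE !andbA.
have := count z x; rewrite eq_sym (exchange_big_dep (mem (through z :\ l))) //=; last first.
  by move=> m l' _ /andP[].
move=> /(_ xz_neq zl xl); have := count x z xz_neq xl zl.
under eq_bigr => m mz do under eq_bigl => l' do rewrite perpC.
have -> : \sum_(m in through z :\ l) \sum_(l' in through x :\ l | perp m l') 1
  = \sum_(m in through z :\ l) \sum_(l' in through x :\ l | (m \in through z :\ l) && perp m l') 1.
  by apply: eq_bigr => m ->.
move=> -> /eqP; rewrite eqn_pmul2r // => /eqP E.
by rewrite (cardsD1 l) lx (cardsD1 l (through z)) lz E.
Qed.

End Perp.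
End Lines.

(** * Spectrum of a distance-regular graph with classical parameters *)

Local Open Scope ring_scope.

Section Spectrum.
Variables (R : rcfType) (T : finType) (adj : rel T) (D : nat).
Hypothesis adj_sym : symmetric adj.
Hypothesis adj_irr : irreflexive adj.
Hypothesis diam : forall x y, within adj D x y.
Local Notation d := (gdist adj D).

Variables (q : nat -> R) (alpha beta : R).
Hypothesis q0 : q 0%N = 0.
Hypothesis q_lt : forall i, q i < q i.+1.
Hypothesis alpha_ge0 : 0 <= alpha.
Hypothesis beta_alpha : forall i, (i < D)%N -> 0 < beta - alpha * q i.

Let bb i := (q D - q i) * (beta - alpha * q i).
Let cc i := q i * (1 + alpha * q i.-1).
Let aa i := q D * beta - bb i - cc i.

Hypothesis card_b : forall x y,
  #|[set z | adj y z & d x z == (d x y).+1]|%:R = bb (d x y).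
Hypothesis card_c : forall x y,
  #|[set z | adj y z & (d x z).+1 == d x y]|%:R = cc (d x y).

Lemma q_ge0 i : 0 <= q i.
Proof. by elim: i => [|i IH]; rewrite ?q0 // (le_trans IH) // ltW. Qed.

Lemma qS_gt0 i : 0 < q i.+1.
Proof. exact: le_lt_trans (q_ge0 i) (q_lt i). Qed.

Lemma q_ltn i j : (i < j)%N -> q i < q j.
Proof. exact: (homo_ltn lt_trans q_lt). Qed.

Lemma one_alpha_gt0 i : 0 < 1 + alpha * q i.
Proof. by rewrite ltr_wpDr ?mulr_ge0 ?q_ge0. Qed.

Lemma valency y : #|[set z | adj y z]|%:R = q D * beta.
Proof.
have := card_b y y; rewrite gdistxx // /bb q0 subr0 mulr0 subr0 => <-.
congr (_ %:R); apply: eq_card => z; rewrite !inE gdist_eq1 //.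
by case: (adj y z).
Qed.

(** A neighbour of [y] is at distance [j - 1], [j] or [j + 1] from [x]; the middle count [aa j] is
    what remains of the valency. For [j = 0] the term at [j.-1 = 0] has the coefficient
    [cc 0 = 0]. *)
Lemma sum_neighbours (g : nat -> R) x y (j := d x y) :
  \sum_(z | adj y z) g (d x z) = cc j * g j.-1 + aa j * g j + bb j * g j.+1.
Proof.
have const (P : pred T) c : (forall z, P z -> g (d x z) = c) ->
    \sum_(z | P z) g (d x z) = #|[set z | P z]|%:R * c.
  by move=> Pc; rewrite (eq_bigr _ Pc) sumr_const mulr_natl cardsE.
have split3 (h : T -> R) : \sum_(z | adj y z) h z =
    \sum_(z | adj y z && ((d x z).+1 == j)) h z
    + \sum_(z | adj y z && (d x z == j)) h z
    + \sum_(z | adj y z && (d x z == j.+1)) h z.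
  rewrite (bigID (fun z => d x z == j.+1)) /= addrC; congr (_ + _).
  rewrite (bigID (fun z => d x z == j)) /= addrC; congr (_ + _);
  apply: eq_bigl => z; have [yz|//] := boolP (adj y z) => /=.
    have := gdist_step diam x yz.
    have : adj z y by rewrite adj_sym.
    move=> /(gdist_step diam x); rewrite -/j; clear; lia.
  by case: (d x z =P j) => [->|_]; rewrite ?andbF //; clear; lia.
have cardA : #|[set z | adj y z && (d x z == j)]|%:R = aa j.
  have := split3 (fun=> 1).
  have cst (P : pred T) : \sum_(z | P z) (1 : R) = #|[set z | P z]|%:R.
    by rewrite sumr_const cardsE.
  rewrite !cst valency card_b card_c -/j /aa => ->.
  ring.
rewrite split3.
rewrite (const _ (g j.-1)); last by move=> z /andP[_ /eqP <-].
rewrite (const _ (g j)); last by move=> z /andP[_ /eqP ->].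
rewrite (const _ (g j.+1)); last by move=> z /andP[_ /eqP ->].
by rewrite card_b card_c cardA.
Qed.

(** * Sums of an eigenfunction over spheres *)

Section Eigenfunction.
Variables (f : T -> R) (theta : R).
Hypothesis eigen_f : forall y, \sum_(z | adj y z) f z = theta * f y.
Variable x : T.
Let F i := \sum_(y | d x y == i) f y.

Let F_mul i : F i = \sum_z f z * (d x z == i)%:R.
Proof. by rewrite /F big_mkcond; apply: eq_bigr => z _; case: eqP; rewrite ?mulr1 ?mulr0. Qed.

(** Sum the eigenvalue equation over the sphere of radius [i] and exchange the sums: the coefficient
    of [f z] is the number of neighbours of [z] on that sphere. *)
Let F_rec_gen i : theta * F i = \sum_z f z *
  (cc (d x z) * ((d x z).-1 == i)%:R + aa (d x z) * (d x z == i)%:R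
   + bb (d x z) * ((d x z).+1 == i)%:R).
Proof.
rewrite /F big_distrr /= (eq_bigr (fun y => \sum_(z | adj y z) f z)); last first.
  by move=> y _; rewrite eigen_f.
rewrite (exchange_big_dep xpredT) //=; apply: eq_bigr => z _.
rewrite -(sum_neighbours (fun j => (j == i)%:R)) big_distrr /=.
rewrite big_mkcondl; apply: eq_big => y; first by rewrite adj_sym.
by rewrite adj_sym; case: eqP; rewrite ?mulr1 ?mulr0.
Qed.

Lemma sphere_sum0 : F 0 = f x.
Proof.
rewrite /F (eq_bigl (pred1 x)) ?big_pred1_eq // => y.
by rewrite gdist_eq0 // eq_sym.
Qed.

Lemma sphere_sum_out i : (D < i)%N -> F i = 0.
Proof. by move=> Di; apply: big1 => y /eqP dy; have := gdist_leD diam x y; lia. Qed.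

Lemma sphere_sum_rec0 : theta * F 0 = cc 1 * F 1 + aa 0 * F 0.
Proof.
rewrite F_rec_gen !F_mul !big_distrr -big_split; apply: eq_bigr => z _ /=.
have cc0 : cc 0 = 0 by rewrite /cc q0 mul0r.
by case: (d x z) => [|[|n]] /=; rewrite ?cc0; ring.
Qed.

Lemma sphere_sum_recS i :
  theta * F i.+1 = cc i.+2 * F i.+2 + aa i.+1 * F i.+1 + bb i * F i.
Proof.
rewrite F_rec_gen !F_mul !big_distrr -!big_split; apply: eq_bigr => z _ /=.
have -> : cc (d x z) * ((d x z).-1 == i.+1)%:R = cc i.+2 * (d x z == i.+2)%:R.
  case: (d x z) => [|n] /=; first by rewrite !mulr0.
  by rewrite eqSS; case: eqP => [->|]; rewrite ?mulr0.
have -> : aa (d x z) * (d x z == i.+1)%:R = aa i.+1 * (d x z == i.+1)%:R.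
  by case: eqP => [->|]; rewrite ?mulr0.
have -> : bb (d x z) * ((d x z).+1 == i.+1)%:R = bb i * (d x z == i)%:R.
  by rewrite eqSS; case: eqP => [->|]; rewrite ?mulr0.
ring.
Qed.

(** This identity makes the ratios [- (q D - q i) / q i.+1] solve the three-term recurrence at
    [theta = - q D]. *)
Let bb_cc_eq i : q D + aa i.+1 - q i.+1 * (beta - alpha * q i)
  = (q D - q i.+1) * (1 + alpha * q i.+1).
Proof. rewrite /aa /bb /cc /=; ring. Qed.

Let aa0_eq : q D + aa 0 = q D.
Proof. by rewrite /aa /bb /cc q0 /=; ring. Qed.

(* Below [- q D] the normalised alternating sphere sums stay positive: they
   dominate those of the eigenvalue [- q D], whose consecutive ratios are
   [(q D - q i) / q i.+1]; positivity past the diameter is absurd. *)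
Lemma eigenvalue_ge : f x != 0 -> - q D <= theta.
Proof.
move=> fx0; rewrite leNgt; apply/negP => th_lt.
pose w i := (-1) ^+ i * F i / f x.
have w0 : w 0%N = 1 by rewrite /w sphere_sum0 expr0 mul1r divff.
have w1 : cc 1 * w 1%N = (aa 0 - theta) * w 0%N.
  have H : cc 1 * F 1 = (theta - aa 0) * F 0 by rewrite mulrBl sphere_sum_rec0 addrK.
  rewrite /w expr1 expr0 mul1r mulrA mulrCA mulN1r H.
  by rewrite mulrA -mulNr opprB.
have wS i : cc i.+2 * w i.+2 = (aa i.+1 - theta) * w i.+1 - bb i * w i.
  have H : cc i.+2 * F i.+2 = (theta - aa i.+1) * F i.+1 - bb i * F i.
    by rewrite mulrBl sphere_sum_recS; ring.
  rewrite /w [cc _ * _]mulrA mulrCA H !exprS; ring.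
have pos : forall i, (i <= D)%N -> 0 < w i /\ (q D - q i) * w i < q i.+1 * w i.+1.
  elim=> [_|i IH lt_iD].
    rewrite w0 ltr01; split=> //; rewrite q0 subr0 mulr1.
    have := w1; rewrite w0 mulr1 /cc /= q0 mulr0 addr0 mulr1 => ->.
    have := aa0_eq; lra.
  have [wi_gt0 lt_w] := IH (ltnW lt_iD).
  have qq := q_ltn lt_iD.
  have w_gt0 : 0 < w i.+1.
    rewrite -(pmulr_rgt0 _ (qS_gt0 i)); apply: lt_trans lt_w.
    by rewrite mulr_gt0 // subr_gt0.
  split=> //; rewrite -(ltr_pM2r (one_alpha_gt0 i.+1)).
  have -> : q i.+2 * w i.+2 * (1 + alpha * q i.+1) = cc i.+2 * w i.+2.
    by rewrite /cc /=; ring.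
  rewrite wS.
  have le1 : bb i * w i <= (beta - alpha * q i) * (q i.+1 * w i.+1).
    rewrite /bb [_ * (beta - _)]mulrC -mulrA ler_pM2l ?beta_alpha //.
    exact: ltW.
  have -> : (q D - q i.+1) * w i.+1 * (1 + alpha * q i.+1)
    = (q D + aa i.+1 - q i.+1 * (beta - alpha * q i)) * w i.+1.
    by rewrite bb_cc_eq; ring.
  have : 0 < (- q D - theta) * w i.+1 by rewrite mulr_gt0 // subr_gt0.
  nra.
have [_] := pos D (leqnn D).
by rewrite /w [F D.+1]sphere_sum_out // mulr0 !(mul0r, mulr0) subrr mul0r ltxx.
Qed.

(** At [- q D] the recurrence determines all sphere sums from [f x], as its leading coefficients are
    nonzero; past the diameter the factor [j = D] makes the product vanish. *)
Lemma sphere_sum_min i : theta = - q D ->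
  F i = (\prod_(j < i) (- ((q D - q j) / q j.+1))) * f x.
Proof.
move=> thE; have [n] := ubnP i; elim: n i => // n IH [_|[_|i]].
- by rewrite big_ord0 mul1r sphere_sum0.
- rewrite big_ord_recr big_ord0 /= mul1r.
  have := sphere_sum_rec0; rewrite sphere_sum0 thE /cc /= q0 mulr0 addr0 mulr1.
  have := aa0_eq; rewrite subr0 => e H.
  have a0 : aa 0 = 0 by lra.
  move: H; rewrite a0 mul0r addr0 => H.
  by rewrite -mulNr mulrAC H mulrAC mulfV ?mul1r ?gt_eqF ?qS_gt0.
move=> lt_n; have F1 := IH i.+1 lt_n; have F2 := IH i (ltnW lt_n).
have F12 : (q D - q i) * F i = - (q i.+1 * F i.+1).
  rewrite F1 F2 big_ord_recr /=.
  have : q i.+1 != 0 by rewrite gt_eqF ?qS_gt0.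
  by move=> qn0; field.
rewrite big_ord_recr /= [_ * - _]mulrC -mulrA -F1.
have qn0 : q i.+2 != 0 by rewrite gt_eqF ?qS_gt0.
have an0 : 1 + alpha * q i.+1 != 0 by rewrite gt_eqF ?one_alpha_gt0.
apply: (mulfI (mulf_neq0 qn0 an0)).
have -> : q i.+2 * (1 + alpha * q i.+1) * F i.+2 =
    (theta - aa i.+1) * F i.+1 - (beta - alpha * q i) * ((q D - q i) * F i).
  have := sphere_sum_recS i; rewrite /cc /bb /= => H.
  by rewrite mulrBl H; ring.
rewrite F12 thE.
have -> : q i.+2 * (1 + alpha * q i.+1) * (- ((q D - q i.+1) / q i.+2) * F i.+1)
   = - ((q D - q i.+1) * (1 + alpha * q i.+1)) * F i.+1 by field.
by rewrite -bb_cc_eq; ring.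
Qed.

End Eigenfunction.

(* The standard sequence of the eigenvalue [- q D]. *)
Definition cosine i := \prod_(j < i) (- ((1 + alpha * q j) / (beta - alpha * q j))).

Lemma cosine_eigen x y :
  \sum_(z | adj y z) cosine (d x z) = - q D * cosine (d x y).
Proof.
rewrite sum_neighbours; have := gdist_leD diam x y.
(* At [j = D] both sides vanish, whatever the value of [cosine D.+1]. *)
have bE j : (j <= D)%N -> bb j * cosine j.+1 = - ((q D - q j) * (1 + alpha * q j)) * cosine j.
  rewrite leq_eqVlt => /orP[/eqP ->|lt_jD]; first by rewrite /bb subrr !mul0r oppr0 mul0r.
  have bn0 : beta - alpha * q j != 0 by rewrite gt_eqF ?beta_alpha.
  by rewrite /cosine big_ord_recr /= /bb; field.
case: (d x y) => [|j] le_j; rewrite bE //.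
  have cc0 : cc 0 = 0 by rewrite /cc q0 mul0r.
  by rewrite cc0 mul0r add0r -mulrDl /aa /bb /cc q0 /=; congr (_ * _); ring.
have bn0 : beta - alpha * q j != 0 by rewrite gt_eqF ?beta_alpha.
have -> : cc j.+1 * cosine j.+1.-1 = - (q j.+1 * (beta - alpha * q j)) * cosine j.+1.
  by rewrite /cosine big_ord_recr /= /cc /=; field.
by rewrite -!mulrDl /aa /bb /cc /=; congr (_ * _); ring.
Qed.

Lemma cosine0 : cosine 0 = 1. Proof. by rewrite /cosine big_ord0. Qed.

Lemma cosine1 : cosine 1 = - beta^-1.
Proof.
by rewrite /cosine big_ord_recr big_ord0 /= q0 mulr0 addr0 subr0 mul1r div1r.
Qed.

(* Up to a positive factor, [x, y |-> cosine (d x y)] is the matrix of the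
   projection on the eigenspace of [- q D]; evaluate its quadratic form at the
   indicator function of [C]. *)
Lemma clique_le (C : {set T}) : (0 < D)%N -> clique adj C -> #|C|%:R <= 1 + beta.
Proof.
move=> D_gt0 /forallP cliqueC.
have beta_gt0 : 0 < beta by have := beta_alpha D_gt0; rewrite q0 mulr0 subr0.
pose g z := \sum_(y in C) cosine (d y z).
have eigen_g y : \sum_(z | adj y z) g z = - q D * g y.
  rewrite /g exchange_big big_distrr /=; apply: eq_bigr => x _.
  exact: cosine_eigen.
(* By [sphere_sum_min], the kernel [cosine (d x y)] acts on eigenfunctions of [- q D] as
   multiplication by [c]. The two products in each term have the same sign, and the term [i = 0] is
   1. *)
pose c := \sum_(i < D.+1) cosine i * \prod_(j < i) (- ((q D - q j) / q j.+1)).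
have c_gt0 : 0 < c.
  rewrite /c big_ord_recl /= cosine0 big_ord0 mul1r ltr_wpDr //.
  apply: sumr_ge0 => i _; rewrite /cosine -big_split /=; apply: prodr_ge0 => j _.
  have jD : (j < D)%N by have := ltn_ord j; have := ltn_ord i; rewrite /bump /=; lia.
  rewrite mulrNN; apply: mulr_ge0; apply: divr_ge0.
  - exact/ltW/one_alpha_gt0.
  - exact/ltW/beta_alpha.
  - by rewrite subr_ge0 ltW // q_ltn.
  - exact/ltW/qS_gt0.
have sum_c y : \sum_z cosine (d y z) * g z = c * g y.
  rewrite (partition_big (fun z => inord (d y z) : 'I_D.+1) xpredT) //= /c big_distrl /=.
  apply: eq_bigr => i _; rewrite -mulrA -(sphere_sum_min eigen_g) // big_distrr /=.
  have dE z : (inord (d y z) == i) = (d y z == i).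
    by rewrite -val_eqE /= inordK // ltnS gdist_leD.
  by apply: eq_big => [z|z]; rewrite dE // => /eqP ->.
have sq_ge0 : 0 <= \sum_z g z * g z by apply: sumr_ge0 => z _; rewrite -expr2 sqr_ge0.
have sqE : \sum_z g z * g z = c * \sum_(y in C) g y.
  rewrite big_distrr /= -(eq_bigr _ (fun y _ => sum_c y)) exchange_big /=.
  by apply: eq_bigr => z _; rewrite -big_distrl.
(* On a clique [g] is constant, so the sum of squares is [c #|C| (1 - (#|C| - 1) / beta)]; its sign
   gives the bound. *)
have gC y : y \in C -> g y = 1 - (#|C|%:R - 1) / beta.
  move=> yC; rewrite /g (bigD1 y) //= gdistxx // cosine0.
  rewrite (eq_bigr (fun=> - beta^-1)); last first.
    move=> x /andP[xC xy]; rewrite -cosine1; congr cosine; apply/eqP.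
    rewrite gdist_eq1 //; have := cliqueC x.
    by rewrite xC /= => /forallP/(_ y); rewrite yC xy.
  rewrite (eq_bigl (mem (C :\ y))); last by move=> x; rewrite !inE andbC.
  rewrite sumr_const; have := cardsD1 y C; rewrite yC => ->.
  by rewrite natrD addrAC subrr add0r mulNrn -[_^-1 *+ _]mulr_natl.
have [->|] := posnP #|C|; first by rewrite addr_ge0 // ltW.
move: sq_ge0; rewrite sqE pmulr_rge0 // (eq_bigr _ gC) sumr_const.
move=> H C_gt0; move: H; rewrite pmulrn_lge0 // subr_ge0 ler_pdivrMr // mul1r.
lra.
Qed.

End Spectrum.

(** * Adjacency and incidence matrices *)

Lemma eigenvalue_adjmx (R : rcfType) (T : finType) (adj : rel T) (th : R) :
  symmetric adj ->
  eigenvalue (adjmx adj R) th <->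
  exists2 f : T -> R, (exists x, f x != 0) &
    forall y, \sum_(z | adj y z) f z = th * f y.
Proof.
move=> adj_sym.
have mulE (v : 'rV[R]_#|T|) j : (v *m adjmx adj R) 0 j =
    \sum_(z | adj (enum_val j) z) v 0 (enum_rank z).
  rewrite mxE [RHS]big_mkcond (reindex _ (onW_bij _ (@enum_rank_bij T))) /=.
  apply: eq_bigr => z _; rewrite mxE enum_rankK adj_sym.
  by case: (adj _ z); rewrite ?mulr1 ?mulr0.
split=> [/eigenvalueP[v vA v0]|[f [x fx] fA]].
  exists (fun z => v 0 (enum_rank z)).
    have /rV0Pn[i vi] := v0; exists (enum_val i); by rewrite enum_valK.
  move=> y; have /rowP/(_ (enum_rank y)) := vA; rewrite mulE enum_rankK => ->.
  by rewrite mxE.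
apply/eigenvalueP; exists (\row_i f (enum_val i)).
  apply/rowP => j; rewrite mulE !mxE -fA; apply: eq_bigr => z _.
  by rewrite mxE enum_rankK.
by apply/rV0Pn; exists (enum_rank x); rewrite mxE enum_rankK.
Qed.

(** The incidence matrix has more rows than columns, hence a nonzero left kernel. *)
Lemma kernel_of_few_lines (R : fieldType) (T : finType) (L : {set {set T}}) :
  (#|L| < #|T|)%N ->
  exists2 f : T -> R, (exists x, f x != 0) &
    forall l, l \in L -> \sum_(z in l) f z = 0.
Proof.
move=> ltLT.
pose N : 'M[R]_(#|T|, #|L|) := \matrix_(i, j) ((enum_val i : T) \in (enum_val j : {set T}))%:R.
have kerN : kermx N != 0.
  by rewrite kermx_eq0 -row_leq_rank -ltnNge (leq_ltn_trans (rank_leq_col N)).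
have [i vi] : exists i, row i (kermx N) != 0.
  by apply/existsP; apply: contraNT kerN => /existsPn H; apply/eqP/row_matrixP => i;
     rewrite row0; apply/eqP; rewrite -[_ == _]negbK H.
have : row i (kermx N) *m N = 0 by rewrite -row_mul mulmx_ker row0.
move: (row i _) vi => v /rV0Pn[j vj] vN.
exists (fun z => v 0 (enum_rank z)).
  by exists (enum_val j); rewrite enum_valK.
move=> l lL; have /rowP/(_ (enum_rank_in lL l)) := vN; rewrite !mxE => E.
rewrite -[RHS]E [LHS]big_mkcond (reindex _ (onW_bij _ (@enum_rank_bij T))) /=.
apply: eq_bigr => z _; rewrite mxE enum_rankK enum_rankK_in //.
by case: (z \in l); rewrite ?mulr1 ?mulr0.
Qed.

(** Counting incidences in two ways gives [#|L| (t + 1) <= #|T| t]. *)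
Lemma few_lines (T : finType) (L : {set {set T}}) (t : nat) :
  (0 < #|T|)%N -> (forall x, #|through L x| <= t)%N ->
  (forall l, l \in L -> (t < #|l|)%N) -> (#|L| < #|T|)%N.
Proof.
move=> T_gt0 t_le l_gt.
have count : (#|L| * t.+1 <= #|T| * t)%N.
  rewrite -!sum_nat_const.
  apply: (@leq_trans (\sum_(l in L) \sum_(x in l) 1)%N).
    by apply: leq_sum => l lL; rewrite sum1_card l_gt.
  rewrite (exchange_big_dep xpredT) //=; apply: leq_sum => x _.
  rewrite sum1_card; apply: leq_trans (t_le x).
  by apply: subset_leq_card; apply/subsetP => l; rewrite inE.
nia.
Qed.

(** On each of the [t] lines through [y], the values of [f] off [y] sum to [- f y]. *)
Lemma kernel_eigen (R : fieldType) (T : finType) (adj : rel T) (L : {set {set T}})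
    (t : nat) (f : T -> R) :
  symmetric adj -> irreflexive adj ->
  (forall x y, x != y -> #|[set l in L | (x \in l) && (y \in l)]| <= 1)%N ->
  (forall x y, adj x y <-> x != y /\ exists2 l, l \in L & (x \in l) && (y \in l)) ->
  (forall x, #|through L x| = t) ->
  (forall l, l \in L -> \sum_(z in l) f z = 0) ->
  forall y, \sum_(z | adj y z) f z = - t%:R * f y.
Proof.
move=> adj_sym adj_irr L_one adj_L tE f0 y.
rewrite (sum_lines adj_irr L_one adj_L) (eq_bigr (fun=> - f y)).
  by rewrite sumr_const tE mulNr mulr_natl mulNrn.
move=> l /throughP[lL yl]; have := f0 l lL; rewrite (bigD1 y) //= => /eqP.
by rewrite addr_eq0 => /eqP ->; rewrite opprK.
Qed.

(** * Graphs with classical parameters and the SPLS property *)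

Section GaussianIntegers.
Variables (R : rcfType) (b : nat).
Hypothesis b_ge2 : (2 <= b)%N.
Local Notation q := (qbr R b).

Lemma qbr0 : q 0 = 0.
Proof. by rewrite /qbr expr0 subrr mul0r. Qed.

Lemma qbrS i : q i.+1 = b%:R * q i + 1.
Proof.
have b1 : b%:R - 1 != 0 :> R by rewrite subr_eq0 gt_eqF // ltr1n.
by rewrite /qbr exprS; field.
Qed.

Lemma qbr1 : q 1 = 1. Proof. by rewrite qbrS qbr0 mulr0 add0r. Qed.
Lemma qbr2 : q 2 = b%:R + 1. Proof. by rewrite qbrS qbr1 mulr1. Qed.
Lemma qbr3 : q 3 = b%:R ^+ 2 + b%:R + 1. Proof. by rewrite qbrS qbr2; ring. Qed.

Lemma qbr_lt i : q i < q i.+1.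
Proof.
have b_gt1 : 1 < b%:R :> R by rewrite ltr1n.
have q_ge0 j : 0 <= q j.
  by elim: j => [|j IH]; rewrite ?qbr0 // qbrS addr_ge0 // mulr_ge0 // ler0n.
by rewrite qbrS; have := q_ge0 i; nra.
Qed.

End GaussianIntegers.

(* With [h = b + 1 + j], the difference of the two sides is
   [(A + b J - (b + 2) (b + 1) (s - 1)) + (j - 1) (A - (2 b + j + 2) (s - 1))]. *)
Lemma trace_numerics (R : realFieldType) (A J b s h : R) :
  0 <= b -> 1 <= s -> b + 2 <= h <= b + 1 + J -> (h = b + 2 \/ 2 <= J) ->
  (b + 2) * (b + 1) * (s - 1) - b * J < A -> (2 * s - 1) * (b + J) + 1 <= A ->
  (b + 1) * A - b * J < h * (A - (h - 1) * (s - 1)).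
Proof.
move=> b0 s1 /andP[h1 h2] hJ lt1 le2.
have -> : h * (A - (h - 1) * (s - 1)) = (b + 1) * A - b * J
   + (A + b * J - (b + 2) * (b + 1) * (s - 1))
   + (h - b - 2) * (A - (b + h + 1) * (s - 1)) by ring.
have : 0 <= (h - b - 2) * (A - (b + h + 1) * (s - 1)).
  case: hJ => [->|J2]; first by rewrite [b + 2 - b]addrC addKr subrr mul0r.
  apply: mulr_ge0; first lra.
  have : 0 <= (2 * J + b - h - 1 + b) * (s - 1) by apply: mulr_ge0; lra.
  nra.
lra.
Qed.

(** * Intersection numbers, smallest eigenvalue and clique bound *)

Section ClassicalParameters.
Variables (R : rcfType) (T : finType) (adj : rel T).
Variables (D b : nat) (alpha beta : R) (bs cs : nat -> nat).
Hypothesis b_ge2 : (2 <= b)%N.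
Hypothesis D_ge3 : (3 <= D)%N.
Hypothesis drg : is_drg adj D bs cs.
Hypothesis params : classical_params R D b alpha beta bs cs.

Local Notation q := (qbr R b).
Local Notation d := (gdist adj D).
Local Notation r := (q D).
Local Notation bR := (b%:R : R).

Let adj_sym : symmetric adj. Proof. by case: drg. Qed.
Let adj_irr : irreflexive adj. Proof. by case: drg. Qed.
Let diam x y : within adj D x y. Proof. by case: drg. Qed.
Let q_lt := qbr_lt R b_ge2.
Let q0 := qbr0 R b.

Lemma exists_gdist i : (i <= D)%N -> exists x y, d x y = i.
Proof.
move=> le_iD; case: drg => _ _ _ [x [y]] + _.
rewrite (dist_isE diam) => /eqP dxy; exists x.
by apply: (@gdist_all _ _ _ diam x y); rewrite dxy.
Qed.

Lemma card_bs x y i : d x y = i -> (i < D)%N ->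
  #|[set z | adj y z & d x z == i.+1]| = bs i.
Proof.
move=> dxy iD; case: drg => _ _ _ _ /(_ i x y).
rewrite (dist_isE diam) dxy eqxx => /(_ isT)[/(_ iD) <- _].
by apply: eq_card => z; rewrite !inE (dist_isE diam).
Qed.

Lemma card_cs x y i : d x y = i.+1 ->
  #|[set z | adj y z & d x z == i]| = cs i.+1.
Proof.
move=> dxy; case: drg => _ _ _ _ /(_ i.+1 x y).
rewrite (dist_isE diam) dxy eqxx => /(_ isT)[_ /(_ isT) <-].
by apply: eq_card => z; rewrite !inE (dist_isE diam).
Qed.

Lemma cs_gt0 i : (i < D)%N -> (0 < cs i.+1)%N.
Proof.
move=> iD; have [x [y dxy]] := exists_gdist iD.
have [z dxz zy] := gdist_pred diam dxy.
rewrite -(card_cs dxy) card_gt0; apply/set0Pn; exists z.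
by rewrite inE adj_sym zy dxz /=.
Qed.

Lemma bs_gt0 i : (i < D)%N -> (0 < bs i)%N.
Proof.
move=> iD; have [x [y dxy]] := exists_gdist iD.
have [z dxz zy] := gdist_pred diam dxy.
rewrite -(card_bs dxz iD) card_gt0; apply/set0Pn; exists y.
by rewrite inE zy dxy /=.
Qed.

Lemma cs2E : (cs 2)%:R = (bR + 1) * (1 + alpha).
Proof. by have [_ ->] := params; rewrite ?qbr2 ?qbr1 ?mulr1 // (leq_trans _ D_ge3). Qed.

Lemma cs3E : (cs 3)%:R = (bR ^+ 2 + bR + 1) * (1 + alpha * (bR + 1)).
Proof. by have [_ ->] := params; rewrite ?qbr3 ?qbr2. Qed.

(* [alpha (b + 1) = c_2 - (b + 1)] is an integer, and it exceeds [-1] because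
   [c_3 > 0]. *)
Lemma alpha_nat : {n : nat | alpha * (bR + 1) = n%:R}.
Proof.
have c3 : 0 < 1 + alpha * (bR + 1).
  have : 0 < (cs 3)%:R :> R by rewrite ltr0n cs_gt0.
  rewrite cs3E pmulr_rgt0 //; have := ler0n R b; nra.
have E : alpha * (bR + 1) = (cs 2)%:R - b.+1%:R by rewrite cs2E -natr1; ring.
exists (cs 2 - b.+1)%N; rewrite natrB // leqNgt; apply/negP => lt_c.
have : (cs 2)%:R + 1 <= b.+1%:R :> R by rewrite natr1 ler_nat.
by move: c3; rewrite E; lra.
Qed.

Lemma alpha_ge0 : 0 <= alpha.
Proof.
have [n E] := alpha_nat; have : 0 <= alpha * (bR + 1) by rewrite E ler0n.
by rewrite pmulr_lge0 // ltr_wpDl.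
Qed.

Lemma beta_alpha_gt0 i : (i < D)%N -> 0 < beta - alpha * q i.
Proof.
move=> iD; have : 0 < (bs i)%:R :> R by rewrite ltr0n bs_gt0.
have [bsE _] := params; rewrite bsE // pmulr_rgt0 // subr_gt0.
exact: (q_ltn q_lt).
Qed.

Lemma card_bR x y : #|[set z | adj y z & d x z == (d x y).+1]|%:R =
  (r - q (d x y)) * (beta - alpha * q (d x y)).
Proof.
have := gdist_leD diam x y; rewrite leq_eqVlt => /orP[/eqP ->|lt_D].
  rewrite subrr mul0r eq_card0 // => z; rewrite !inE.
  by have := gdist_leD diam x z; case: eqP => [->|]; rewrite ?andbF ?ltnn.
by have [bsE _] := params; rewrite (card_bs (erefl _) lt_D) bsE.
Qed.

Lemma card_cR x y : #|[set z | adj y z & (d x z).+1 == d x y]|%:R =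
  q (d x y) * (1 + alpha * q (d x y).-1).
Proof.
have := gdist_leD diam x y.
case E : (d x y) => [|i] iD.
  by rewrite q0 mul0r eq_card0 // => z; rewrite !inE andbF.
have [_ csE] := params; rewrite -csE // -(card_cs E); congr (_ %:R); apply: eq_card => z; rewrite !inE eqSS.
Qed.

Lemma beta_gt0 : 0 < beta.
Proof.
by have := @beta_alpha_gt0 0; rewrite q0 mulr0 subr0; apply; apply: leq_trans D_ge3.
Qed.

Lemma r_ge : bR ^+ 2 + bR + 1 <= r.
Proof. by rewrite -qbr3 //; exact: (homo_leq lexx le_trans (fun i => ltW (q_lt i))). Qed.

Lemma valencyE x : #|[set z | adj x z]|%:R = r * beta.
Proof. exact: (valency adj_irr diam q0 card_bR). Qed.

Lemma bs0E : (bs 0)%:R = r * beta.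
Proof. by have [bsE _] := params; rewrite bsE ?q0 ?mulr0 ?subr0 // (leq_trans _ D_ge3). Qed.

(** The neighbours of [x] left out are those at distance 3 from [y], [b_2] in number, so the value
    is [k - b_2]. *)
Lemma near_valency x y : d x y = 2 -> #|[set z | adj x z & (d y z <= 2)%N]|%:R
  = (bR + 1) * (beta + alpha * (r - 1)) - bR * (alpha * (bR + 1)).
Proof.
move=> dxy; have := valencyE x.
have dyx : d y x = 2 by rewrite gdistC.
have -> : #|[set z | adj x z]| = (#|[set z | adj x z & (d y z <= 2)%N]| + bs 2)%N.
  rewrite -(card_bs dyx D_ge3) -cardsUI [X in (_ + X)%N](_ : _ = 0)%N ?addn0; last first.
    by apply: eq_card0 => z; rewrite !inE; case: (d y z =P 3) => [->|]; rewrite ?andbF.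
  apply: eq_card => z; rewrite !inE; case xz : (adj x z) => //=.
  by have := gdist_step diam y xz; rewrite dyx -[(d y z <= 2)%N]ltnS orbC -leq_eqVlt => ->.
have [bsE _] := params; rewrite natrD bsE //.
by rewrite qbr2 // => H; apply: (addIr ((r - (bR + 1)) * (beta - alpha * (bR + 1)))); rewrite H; ring.
Qed.

(** This is [a_1], read off by applying [sum_neighbours] to the indicator of distance 1. *)
Lemma common_adj x y : adj x y ->
  #|[set z | adj x z & adj y z]|%:R = beta + alpha * (r - 1) - 1.
Proof.
rewrite -(gdist_eq1 adj_irr diam) => /eqP dxy.
have := sum_neighbours adj_sym adj_irr diam q0 card_bR card_cR (fun j => (j == 1%N)%:R) x y.
rewrite dxy /= !mulr0 addr0 add0r mulr1 qbr1 // q0.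
have -> : \sum_(z | adj y z) ((d x z == 1%N)%:R : R) = #|[set z | adj x z & adj y z]|%:R.
  rewrite -sum1_card natr_sum [RHS]big_mkcond /= [LHS]big_mkcond.
  apply: eq_bigr => z _; rewrite inE gdist_eq1 //.
  by case: (adj x z); case: (adj y z).
by move=> ->; ring.
Qed.

Lemma common_dist2 x y : d x y = 2 -> #|[set z | adj x z & adj y z]| = cs 2.
Proof.
move=> dxy; rewrite -(card_cs dxy); apply: eq_card => z.
by rewrite !inE gdist_eq1 // andbC.
Qed.

Lemma common_dist3 x w : d x w = 3 -> #|[set z | adj x z & d w z == 2]| = cs 3.
Proof. by rewrite gdistC // => dxw; rewrite -(card_cs dxw). Qed.

Lemma eigenvalue_min : is_min_eigenvalue (adjmx adj R) (- r).
Proof.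
split.
  apply/eigenvalue_adjmx => //; have [x [y _]] := exists_gdist (leq0n D).
  exists (fun z => cosine q alpha beta (d x z)).
    by exists x; rewrite gdistxx // cosine0 oner_eq0.
  by move=> z; rewrite (cosine_eigen adj_sym adj_irr diam q0 beta_alpha_gt0 card_bR card_cR).
move=> th /(eigenvalue_adjmx _ adj_sym)[f [x fx] f_eigen].
exact: (eigenvalue_ge adj_sym adj_irr diam q0 q_lt alpha_ge0 beta_alpha_gt0
  card_bR card_cR f_eigen fx).
Qed.

Lemma clique_card (C : {set T}) : clique adj C -> #|C|%:R <= 1 + beta.
Proof.
by apply: (clique_le adj_sym adj_irr diam q0 q_lt alpha_ge0 beta_alpha_gt0
  card_bR card_cR); apply: leq_trans D_ge3.
Qed.

(** * Consequences of the SPLS property and of the three bounds on [beta] *)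

Section StronglyPartialLinear.
Variable s : nat.
Hypothesis sp : spls adj (bs 0 - bs 1 - cs 1)%N (cs 2) s.
Local Notation sR := (s%:R : R).
Hypothesis beta_gt1 :
  (bR + 2) * (bR + 1) * (sR - 1) - (bR * (bR + 1) + r - 1) * alpha < beta.
Hypothesis beta_gt2 :
  ((bR + 1) * (bR ^+ 2 + bR + 1) - 2) * (sR - bR)
    - alpha * (bR + 1) * r + alpha * (bR + 1) ^+ 2 < beta.
Hypothesis beta_gt3 :
  ((bR + 1) * (bR ^+ 2 + bR + 1) - 2 + bR) * (sR - bR)
    - alpha * (r - 1) + bR ^+ 2 - bR < beta.

Let L := lines adj (bs 0 - bs 1 - cs 1 + 2 - (cs 2 - 1) * (s - 1)).
Local Notation through := (through L).
Local Notation trace := (trace adj).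
Local Notation near := (near adj L D).

Let L_max l : l \in L -> maxclique adj l.
Proof. by rewrite inE => /andP[]. Qed.
Let L_one x y : x != y -> (#|[set l in L | (x \in l) && (y \in l)]| <= 1)%N.
Proof. by case: sp => _ _ _ [H _ _ _]; apply: H. Qed.
Let adj_L x y : adj x y <-> x != y /\ exists2 l, l \in L & (x \in l) && (y \in l).
Proof. by case: sp => _ _ _ [_ H _ _]; apply: H. Qed.
Let through_le x : (#|through x| <= s)%N.
Proof. by case: sp => _ _ _ [_ _ H _]; apply: H. Qed.
Let s_ge2 : (2 <= s)%N. Proof. by case: sp. Qed.

(** [A] is [a_1 + 1], and [J] below is [c_2 - (b + 1)]. *)
Let A := beta + alpha * (r - 1).
Let J := alpha * (bR + 1).

Lemma trace_le_cs2 x l : l \in L -> x \notin l -> (#|trace x l| <= cs 2)%N.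
Proof.
move=> lL xl; case: sp => _ _ _ [_ _ _ /(_ x l lL xl)]; apply: leq_trans.
apply: subset_leq_card; apply/subsetP => y; rewrite !inE => /andP[-> /adj_L[_ [m mL xym]]].
by apply/exists_inP; exists m.
Qed.

Lemma a1_ge : (2 * sR - 1) * (bR + J) + 1 <= A.
Proof.
have [x [y dxy]] := exists_gdist (leq_trans (isT : 1 <= 3)%N D_ge3).
have xy : adj x y by rewrite -(gdist_eq1 adj_irr diam) dxy.
have a1 := common_adj xy.
have D_gt1 : (1 < D)%N by apply: leq_trans D_ge3.
have aE : (bs 0 - bs 1 - cs 1)%:R = A - 1 :> R.
  have [bsE csE] := params.
  have E : (bs 0)%:R - (bs 1)%:R - (cs 1)%:R = A - 1 :> R.
    by rewrite bs0E bsE // csE // ?qbr1 // ?q0 ?(ltnW D_gt1) // /A; ring.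
  (* The truncated subtraction defining [a_1] is exact, since [A - 1] counts common neighbours. *)
  have le1 : (bs 1 + cs 1 <= bs 0)%N.
    rewrite -(ler_nat R) natrD; have : 0 <= A - 1 by rewrite -/A in a1; rewrite -a1 ler0n.
    by rewrite -E; lra.
  by rewrite -subnDA natrB // natrD -E; ring.
have := sp; case=> c_ge1 _ + _; rewrite -(ler_nat R) aE natrM !natrB //; last first.
  by rewrite muln_gt0 (ltnW s_ge2).
by rewrite natrM cs2E /J; lra.
Qed.

Lemma line_card_ge2 l : l \in L -> (2 <= #|l|)%N.
Proof.
rewrite inE => /andP[_]; apply: leq_trans.
case: sp => _ _ + _.
move: (_ - _ - cs 1)%N (cs 2) => a c; nia.
Qed.

Lemma line_ge tau l : l \in L -> (0 < tau)%N ->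
  (forall y m, m \in L -> y \notin m -> #|trace y m| <= tau)%N ->
  A - (tau%:R - 1) * (sR - 1) <= #|l|.-1%:R.
Proof.
move=> lL tau_gt0 tau_le.
have /card_gt0P[x xl] : (0 < #|l|)%N by apply: leq_trans (line_card_ge2 lL).
have /card_gt0P[z] : (0 < #|l :\ x|)%N.
  by have := line_card_ge2 lL; rewrite (cardsD1 x) xl.
rewrite !inE => /andP[zx zl]; rewrite eq_sym in zx.
have := common_lines adj_irr L_one adj_L lL xl zl zx (through_le x) tau_le.
rewrite -(ler_nat R) !natrD natrM !natrB ?(ltnW s_ge2) //.
rewrite (common_adj (line_adj adj_L lL xl zl zx)) -/A.
rewrite -[#|l|]prednK ?(leq_trans _ (line_card_ge2 lL)) // -natr1 /=; lra.
Qed.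

(** With [n] near lines, their points other than [x] would outnumber the [(b + 1) A - b J]
    neighbours of [x] within distance 2 of [y]. *)
Lemma card_near_lt x y n lb : d x y = 2 -> 0 <= lb ->
  (forall l, l \in L -> lb <= #|l|.-1%:R) ->
  (bR + 1) * A - bR * J < n%:R * lb -> (#|near x y| < n)%N.
Proof.
move=> dxy lb0 l_ge lt_n; rewrite ltnNge; apply/negP => le_n.
have := near_sum_le D adj_irr L_one adj_L x y.
rewrite -(ler_nat R) near_valency // -/A -/J natr_sum leNgt => /negP; apply.
apply: (lt_le_trans lt_n); apply: (@le_trans _ _ (#|near x y|%:R * lb)).
  by rewrite ler_wpM2r // ler_nat.
rewrite mulr_natl -sumr_const; apply: ler_sum => l /nearP[/throughP[lL _] _].
exact: l_ge.
Qed.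

Let bJ_ge0 : 0 <= bR + J. Proof. by rewrite addr_ge0 ?mulr_ge0 ?addr_ge0 ?alpha_ge0 ?ler0n. Qed.
Let s1_ge1 : 1 <= sR - 1. Proof. by rewrite lerBrDr -(natrD _ 1 1) ler_nat. Qed.
Let A_gt : (bR + 2) * (bR + 1) * (sR - 1) - bR * J < A.
Proof.
rewrite -subr_gt0; move: beta_gt1; rewrite -subr_gt0; congr (0 < _).
by rewrite /A /J; ring.
Qed.

Lemma trace_le x m : m \in L -> x \notin m -> (#|trace x m| <= b.+1)%N.
Proof.
move=> mL xm; rewrite leqNgt; apply/negP => lt_x.
pose P h := [exists y, exists m in L, (y \notin m) && (#|trace y m| == h)].
have exP : exists h, P h.
  by exists #|trace x m|; apply/existsP; exists x; apply/exists_inP; exists m; rewrite ?xm ?eqxx.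
have P_le h : P h -> (h <= cs 2)%N.
  by case/existsP=> y /exists_inP[l lL /andP[yl /eqP <-]]; apply: trace_le_cs2.
(* The largest trace [h] serves twice: as the bound [tau] in [line_ge], and, through [trace_near],
   as a lower bound on the number of near lines. If [h > b + 1], then [trace_numerics] makes the two
   incompatible. *)
case: (ex_maxnP exP P_le) => h Ph h_max.
have tau_le y l : l \in L -> y \notin l -> (#|trace y l| <= h)%N.
  move=> lL yl; apply: h_max; apply/existsP; exists y; apply/exists_inP; exists l => //.
  by rewrite yl eqxx.
have h_gt : (b.+1 < h)%N by apply: leq_trans lt_x (tau_le _ _ mL xm).
have h_le := P_le h Ph.
case/existsP: Ph => u /exists_inP[l lL /andP[ul /eqP hE]].
have [v vl uv] := line_nonadj adj_sym L_max lL ul.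
have duv : d u v = 2.
  have uv_neq : u != v by apply: contraNneq ul => ->.
  have /card_gt0P[w] : (0 < #|trace u l|)%N by rewrite hE (leq_ltn_trans _ h_gt).
  rewrite inE -(gdist_eq1 adj_irr diam) => /andP[wl /eqP duw].
  have le2 : (d u v <= 2)%N by have := gdist_line diam adj_L u lL wl vl; rewrite duw.
  apply/eqP; rewrite eqn_leq le2 ltn_neqAle eq_sym (gdist_eq1 adj_irr diam) uv.
  by rewrite lt0n gdist_eq0.
have h_real : bR + 2 <= h%:R <= bR + 1 + J.
  have : (b.+2)%:R <= (h%:R : R) <= (cs 2)%:R by rewrite !ler_nat h_gt.
  by rewrite cs2E -addn2 natrD /J; lra.
have h_cases : h%:R = bR + 2 \/ 2 <= J.
  move: h_gt; rewrite leq_eqVlt => /orP[/eqP <-|lt_h].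
    by left; rewrite -addn2 natrD.
  right; have : (b + 3)%:R <= (cs 2)%:R :> R by rewrite ler_nat (leq_trans _ h_le) // addn3.
  by rewrite natrD cs2E /J; lra.
have s_ge1 : 1 <= sR by rewrite ler1n ltnW.
have lt_h := trace_numerics (ler0n R b) s_ge1 h_real h_cases A_gt a1_ge.
have := trace_near adj_irr diam L_one adj_L lL ul vl uv.
rewrite hE leqNgt => /negP; apply.
apply: card_near_lt duv _ _ lt_h; last by move=> k kL; apply: line_ge => //; apply: leq_ltn_trans h_gt.
case/andP: h_real => _ h_real.
have := a1_ge; have : (h%:R - 1) * (sR - 1) <= (bR + J) * (sR - 1).
  by rewrite ler_wpM2r //; lra.
have : 0 <= (bR + J) * sR by rewrite mulr_ge0.
nra.
Qed.

Lemma line_ge_b l : l \in L -> A - bR * (sR - 1) <= #|l|.-1%:R.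
Proof. by move=> lL; have := line_ge lL (ltn0Sn b) trace_le; rewrite -natr1 addrK. Qed.

Lemma near_le x y : d x y = 2 -> (#|near x y| <= b.+1)%N.
Proof.
move=> dxy; apply: (@card_near_lt _ _ b.+2 (A - bR * (sR - 1))) dxy _ line_ge_b _.
  have s1_ge0 : 0 <= sR - 1 by apply: le_trans s1_ge1.
  have s_ge0 : 0 <= bR * sR by rewrite mulr_ge0.
  have : 0 <= J * (2 * sR - 1).
    rewrite /J; apply: mulr_ge0; first by rewrite mulr_ge0 ?alpha_ge0 // addr_ge0.
    by move: s1_ge1; lra.
  have := a1_ge; move: s_ge0; lra.
have -> : b.+2%:R = bR + 2 :> R by rewrite -addn2 natrD.
have : 0 < (bR + 2) * (sR - 1) by apply: mulr_gt0 (lt_le_trans ltr01 s1_ge1); rewrite ltr_wpDl.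
have := A_gt; nra.
Qed.

(** At most [b + 1] near lines with at most [b + 1] common neighbours each give
    [c_2 <= (b + 1)^2]. *)
Lemma alpha_le : alpha <= bR.
Proof.
have [x [y dxy]] := exists_gdist (leq_trans (isT : 2 <= 3)%N D_ge3).
have := common_near adj_irr diam L_one adj_L dxy trace_le.
rewrite common_dist2 // => /leq_trans/(_ (leq_mul (near_le dxy) (leqnn _))).
rewrite -(ler_nat R) natrM cs2E -natr1 ler_pM2l ?ltr_wpDl //; lra.
Qed.

Let M := ((b + 1) * (b ^ 2 + b + 1) - 1)%N.
Let M_real : M%:R = (bR + 1) * (bR ^+ 2 + bR + 1) - 1.
Proof. by rewrite natrB ?natrM ?natrD ?natrX // muln_gt0 !addn1. Qed.
Let M1_real : M.-1%:R = (bR + 1) * (bR ^+ 2 + bR + 1) - 2.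
Proof.
have M_gt0 : (0 < M)%N by rewrite /M; nia.
by move: M_real; rewrite -{1}[M]prednK // -natr1; lra.
Qed.

(** The quotient [c_3 (b + 1) / c_2] falls short of [(b + 1) (b^2 + b + 1)] by
    [b (b^2 + b + 1) / (1 + alpha)], which is at least 1 because [alpha <= b]. *)
Lemma cs3_le : (cs 3 * b.+1 <= M * cs 2)%N.
Proof.
rewrite -(ler_nat R) !natrM cs3E cs2E M_real -natr1.
rewrite [_ * (1 + alpha)]mulrC mulrA.
have b1 : 0 < bR + 1 by rewrite ltr_wpDl.
rewrite ler_pM2r //.
have b2 : 2 <= bR by rewrite ler_nat.
have := alpha_le; have := alpha_ge0; nra.
Qed.

Lemma degreeE x : \sum_(l in through x) #|l|.-1%:R = r * beta.
Proof.
by rewrite -(valencyE x) (degree_lines adj_irr L_one adj_L) natr_sum.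
Qed.

Lemma line_le l : l \in L -> #|l|.-1%:R <= beta.
Proof.
move=> lL; have /andP[cl _] := L_max lL; have := clique_card cl.
by rewrite -{1}[#|l|]prednK ?(leq_trans _ (line_card_ge2 lL)) // -natr1; lra.
Qed.

Lemma r_le_through x : r <= #|through x|%:R.
Proof.
rewrite -(ler_pM2r beta_gt0) -(degreeE x) mulr_natl -sumr_const.
by apply: ler_sum => l /throughP[lL _]; apply: line_le.
Qed.

Let s_ge : bR ^+ 2 + bR + 1 <= sR.
Proof.
have [x _] := exists_gdist (leq0n D).
by rewrite (le_trans r_ge) // (le_trans (r_le_through x)) // ler_nat.
Qed.

Let b_lt_s : (b < s)%N.
Proof. by rewrite -(ltr_nat R) (lt_le_trans _ s_ge) //; have := sqr_ge0 bR; lra. Qed.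

(** Assumption (3) rearranges to [(s - b) (M - 1) < A - b (s - 1)], whose right side is the bound of
    [line_ge_b]. *)
Lemma line_gt l : l \in L -> ((s - b) * M.-1 < #|l|.-1)%N.
Proof.
move=> lL; rewrite -(ltr_nat R) natrM natrB 1?ltnW // M1_real.
by apply: lt_le_trans (line_ge_b lL); rewrite /A; move: beta_gt3; lra.
Qed.

Lemma card_near x y : d x y = 2 -> #|near x y| = b.+1.
Proof.
(* Since [beta] is real, the natural number [B], the largest line size minus one, replaces it in
   [near_sum_ge]. The resulting inequality is the negation of (2), once [B] is bounded by [beta]. *)
move=> dxy; apply/eqP; rewrite eqn_leq near_le // ltnNge; apply/negP => le_b.
pose B := \max_(l in L) #|l|.-1.
have [l0 /throughP[l0L _]] : exists l, l \in through x.
  apply/set0Pn; rewrite -card_gt0 -(ltr_nat R) (lt_le_trans _ (r_le_through x)) //.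
  by have := r_ge; have := sqr_ge0 bR; have := ler0n R b; lra.
have MB : (M.-1 <= B)%N.
  apply: leq_trans (leq_bigmax_cond _ l0L); apply: leq_trans (ltnW (line_gt l0L)).
  by rewrite leq_pmull // subn_gt0.
have B_beta : B%:R <= beta.
  have [l lL ->] : {l | l \in L & B = #|l|.-1}.
    by apply: eq_bigmax_cond; rewrite card_gt0; apply/set0Pn; exists l0.
  exact: line_le.
have := near_sum_ge adj_sym adj_irr diam L_one adj_L through_le trace_le
  common_dist2 common_dist3 (cs_gt0 (leq_trans (isT : 2 <= 3)%N D_ge3)) cs3_le dxy MB
  (fun l lL => leq_bigmax_cond _ lL) b_lt_s le_b.
rewrite -(ler_nat R) near_valency // natrD !natrM natrB 1?ltnW // M1_real.
have : bR * B%:R <= bR * beta by rewrite ler_wpM2l ?ler0n.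
move: beta_gt2; lra.
Qed.

Lemma through_const x y : #|through x| = #|through y|.
Proof.
have step u v : adj u v -> #|through u| = #|through v|.
  apply: (through_adj adj_sym adj_irr diam L_max L_one adj_L through_le trace_le
    common_dist2 common_dist3 (cs_gt0 (leq_trans (isT : 2 <= 3)%N D_ge3)) cs3_le
    card_near b_lt_s line_gt); exact: ltnW.
move E : (d x y) => n; elim: n y E => [|n IH] y dxy.
  by move/eqP: dxy; rewrite gdist_eq0 // => /eqP ->.
by have [z /IH -> /step] := gdist_pred diam dxy.
Qed.

Lemma through_le_r x : #|through x|%:R <= r.
Proof.
have few : (#|L| < #|T|)%N.
  apply: (@few_lines _ _ #|through x|) => [|y|l lL].
  - by apply/card_gt0P; exists x.
  - by rewrite (through_const y x).
  have := line_gt lL; have := through_le x.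
  (* Lines then have more than [s] points, hence more than the number of lines through [x]. The
     inequality follows from [M - 1 >= 2] and [s >= b^2 + b + 1 >= 2 b]. *)
  have : (s <= (s - b) * M.-1)%N.
    rewrite -(ler_nat R) natrM natrB 1?ltnW // M1_real.
    have b2 : 2 <= bR by rewrite ler_nat.
    have bb : 2 * bR <= bR ^+ 2 by rewrite expr2 ler_pM2r // (lt_le_trans _ b2).
    have F_ge : 2 <= (bR + 1) * (bR ^+ 2 + bR + 1) - 2.
      by have := mulr_ge0 (ler0n R b) (sqr_ge0 bR); lra.
    have sb : 0 <= sR - bR by rewrite subr_ge0 ler_nat ltnW.
    have := ler_wpM2l sb F_ge; move: s_ge; lra.
  move=> h1 h2 h3; apply: leq_trans (leq_pred _).
  by apply: leq_ltn_trans h3; apply: leq_trans h1.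
have [f f_neq0 f_lines] := kernel_of_few_lines R few.
have [_ /(_ (- #|through x|%:R))] := eigenvalue_min; rewrite lerN2; apply.
apply/eigenvalue_adjmx => //; exists f => //.
apply: (kernel_eigen adj_sym adj_irr L_one adj_L) f_lines => y.
exact: through_const.
Qed.

(** At most [r] lines through a point, each with at most [beta] further points, cover [r beta]
    neighbours, so every bound is attained. *)
Lemma line_delsarte l : l \in L -> #|l|%:R = 1 + beta.
Proof.
move=> lL; have /card_gt0P[x xl] : (0 < #|l|)%N by apply: leq_trans (line_card_ge2 lL).
have lx : l \in through x by rewrite inE lL.
have := degreeE x; rewrite (bigD1 l) //=.
have : \sum_(m in through x | m != l) #|m|.-1%:R <= (#|through x|%:R - 1) * beta.
  rewrite (cardsD1 l (through x)) lx natrD addrAC subrr add0r mulr_natl -sumr_const.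
  rewrite [X in X <= _](eq_bigl (fun m => m \in through x :\ l)); last by move=> m; rewrite in_setD1 andbC.
  by apply: ler_sum => m; rewrite in_setD1 => /andP[_ /throughP[mL _]]; apply: line_le.
have : #|through x|%:R * beta <= r * beta by rewrite ler_pM2r ?beta_gt0 ?through_le_r.
have := line_le lL.
have -> : #|l|%:R = #|l|.-1%:R + 1 :> R.
  by rewrite natr1 prednK // (leq_trans _ (line_card_ge2 lL)).
lra.
Qed.

Lemma spls_geometric : geometric adj R (bs 0).
Proof.
exists (- r); split; first exact: eigenvalue_min.
exists L; split=> [C CL|x y xy].
  have /andP[cl _] := L_max CL; split=> //.
  have r_gt0 : 0 < r by have := r_ge; have := sqr_ge0 bR; have := ler0n R b; lra.
  by rewrite line_delsarte // opprK bs0E mulrAC mulfV ?mul1r // gt_eqF.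
have [xy_neq [l lL xyl]] := (adj_L x y).1 xy.
apply/eqP; rewrite eqn_leq L_one //= card_gt0; apply/set0Pn; exists l.
by rewrite inE lL.
Qed.

End StronglyPartialLinear.

End ClassicalParameters.

Theorem theorem15 (R : rcfType) (T : finType) (adj : rel T)
    (D b : nat) (alpha beta : R) (bs cs : nat -> nat) (s : nat) :
  (2 <= b)%N -> (3 <= D)%N ->
  is_drg adj D bs cs ->
  classical_params R D b alpha beta bs cs ->
  (0 < s)%N ->
  spls adj (bs 0 - bs 1 - cs 1)%N (cs 2) s ->
  let r := qbr R b D in
  let bR : R := b%:R in
  let sR : R := s%:R in
  beta > (bR + 2) * (bR + 1) * (sR - 1) - (bR * (bR + 1) + r - 1) * alpha ->
  beta > ((bR + 1) * (bR ^+ 2 + bR + 1) - 2) * (sR - bR)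
         - alpha * (bR + 1) * r + alpha * (bR + 1) ^+ 2 ->
  beta > ((bR + 1) * (bR ^+ 2 + bR + 1) - 2 + bR) * (sR - bR)
         - alpha * (r - 1) + bR ^+ 2 - bR ->
  geometric adj R (bs 0).
Proof.
move=> b_ge2 D_ge3 drg params _ sp r bR sR gt1 gt2 gt3.
exact: (spls_geometric b_ge2 D_ge3 drg params sp).
Qed.
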